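(* Let $\lambda>0$, $u(x)=\sqrt\lambda\,x$ and $S=\sqrt\lambda+G$ with $G\sim N(0,1)$. There exists $\alpha_0=\alpha_0(\lambda)>0$ such that for all $0<\alpha<\alpha_0$ the saddle point problem $\sup_{x\in(-1,1)}\inf_{q\in[0,1)}\Phi(x,q)$ is achieved at a unique pair $(x_{\rm Bayes},q_{\rm Bayes})$, which solves the system $$x=\frac q{1-q}\qquad\text{and}\qquad\alpha\lambda(1-x^2)=\frac q{(1-q)^2}.$$ These equations admit the explicit solutions $$x_{\rm Bayes}=\frac{\alpha\lambda}{1+\alpha\lambda},\qquad q_{\rm Bayes}=\frac{\alpha\lambda}{1+2\alpha\lambda}.$$
   Context: For $(x,q)\in(-1,1)\times[0,1)$, with $Z,W\sim N(0,1)$ and $S$ mutually independent, $\mathbb E_W$ the expectation over $W$ and $\mathbb E$ that over $(Z,S)$, $$\Phi(x,q)=\alpha\,\mathbb E\log\mathbb E_W\exp u\big(xS+\sqrt{(1-x^2)q}\,Z+\sqrt{(1-x^2)(1-q)}\,W\big)+\frac12\frac q{1-q}+\frac12\log\big((1-x^2)(1-q)\big).$$ The saddle point problem is achieved at a unique pair $(x_\star,q_\star)$ if there is a unique $x_\star\in[0,1)$ achieving $\sup_{x\in(-1,1)}\inf_{q\in[0,1)}\Phi(x,q)$, and a unique $q_\star\in[0,1)$ achieving $\inf_{q\in[0,1)}\Phi(x_\star,q)$. *)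

(* Defs.v *)
From HB Require Import structures.
From mathcomp Require Import all_boot all_order all_algebra.
From mathcomp Require Import all_classical all_reals all_analysis.

Set Implicit Arguments.
Unset Strict Implicit.
Unset Printing Implicit Defensive.

Import Order.TTheory GRing.Theory Num.Theory.
Import numFieldNormedType.Exports.

Local Open Scope classical_set_scope.
Local Open Scope ring_scope.
Local Open Scope ereal_scope.

(* As A, B, C may be [setT], the product rule for pairs is included. *)
Definition mutually_independent3 d (T : measurableType d) (R : realType)
    (P : probability T R) (X Y Z : {RV P >-> R}) : Prop :=
  forall A B C : set R, measurable A -> measurable B -> measurable C ->
    P (X @^-1` A `&` Y @^-1` B `&` Z @^-1` C) =
    P (X @^-1` A) * P (Y @^-1` B) * P (Z @^-1` C).

(* In the inner expectation only [W] is integrated (over [w]), while [S] and [Z]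
   are frozen at the outer sample point [t]; as W is independent of (Z, S), this
   is the expectation over W alone. *)
Definition Phi d (T : measurableType d) (R : realType) (P : probability T R)
    (u : R -> R) (alpha : R) (S Z W : {RV P >-> R}) (x q : R) : \bar R :=
  alpha%:E *
    \int[P]_t lne 'E_P[(fun w => expR (u (x * S t
                           + Num.sqrt ((1 - x ^+ 2) * q) * Z t
                           + Num.sqrt ((1 - x ^+ 2) * (1 - q)) * W w)))%R]
  + (2^-1 * (q / (1 - q)) + 2^-1 * ln ((1 - x ^+ 2) * (1 - q)))%:E.

Definition inf_q (R : realType) (F : R -> R -> \bar R) (x : R) : \bar R :=
  ereal_inf [set F x q | q in (`[0%R, 1%R[)%classic].

Definition sup_inf (R : realType) (F : R -> R -> \bar R) : \bar R :=
  ereal_sup [set inf_q F x | x in (`](-1)%R, 1%R[)%classic].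

(* The supremum ranges over x in (-1, 1), but its maximizer is only sought, and
   only required to be unique, in [0, 1). *)
Definition achieved_at_unique_pair (R : realType) (F : R -> R -> \bar R)
    (x q : R) : Prop :=
  unique (fun x' : R => (0 <= x' < 1)%R /\ inf_q F x' = sup_inf F) x /\
  unique (fun q' : R => (0 <= q' < 1)%R /\ F x q' = inf_q F x) q.

(* Main.v *)
(* Since u is linear, the inner expectation is a Gaussian moment generating
   function, so with a = alpha lambda, s = 1 - x^2 and r = 1 - q,
     Phi(x, q) = a x + a s r / 2 + (q / r + ln s + ln r) / 2.
   The pair x* = a / (1 + a), q* = a / (1 + 2 a) is a strict saddle point,
     Phi(x, q* ) < Phi(x*, q* ) < Phi(x*, q)  for x <> x* and q <> q*,
   because ln y <= y - 1, applied to y = s / s* and to y = r* / r, turns each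
   difference into a positive multiple of (x - x* )^2, resp. (q - q* )^2.  This
   works for every alpha > 0, so alpha_0 can be arbitrary. *)
Require Import Defs.
From HB Require Import structures.
From mathcomp Require Import all_boot all_order all_algebra.
From mathcomp Require Import all_classical all_reals all_analysis.
From mathcomp Require Import measurable_realfun ring lra.

Import Order.TTheory GRing.Theory Num.Theory.
Import numFieldNormedType.Exports.

Local Open Scope classical_set_scope.
Local Open Scope ring_scope.

Set Implicit Arguments.
Unset Strict Implicit.
Unset Printing Implicit Defensive.

(** * Gaussian integrals and moments *)

(** The Radon-Nikodym derivative of the law and [normal_pdf] have the same integral over every
    measurable set, hence agree almost everywhere. *)
Lemma ge0_integral_normal_prob (R : realType) (m s : R) (f : _ -> \bar R) :
  measurable_fun setT f -> (forall x, 0 <= f x)%E ->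
  (\int[normal_prob m s]_x f x =
   \int[lebesgue_measure]_x (f x * (normal_pdf m s x)%:E))%E.
Proof.
move=> mf f0.
have dom := normal_prob_dominates m s.
rewrite -(Radon_Nikodym_SigmaFinite.change_of_variables dom f0 measurableT mf).
have mpdf : measurable_fun setT (fun x => (normal_pdf m s x)%:E).
  by apply/measurable_EFinP; exact: measurable_normal_pdf.
have intRN := Radon_Nikodym_SigmaFinite.f_integrable dom.
have mRN := measurable_int _ intRN.
apply: ae_eq_integral => //; [exact: emeasurable_funM..|].
apply: ae_eqe_mul2l; apply: integral_ae_eq => // A _ mA.
by rewrite -(Radon_Nikodym_SigmaFinite.f_integral dom).
Qed.

(** Completing the square turns e^(bx) times the N(0,1) density into e^(b^2/2) times the N(b,1)
    density, whose mass is 1. *)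
Lemma mgf_normal_prob (R : realType) (b : R) :
  (\int[normal_prob 0 1]_x (expR (b * x))%:E = (expR (b ^+ 2 / 2))%:E)%E.
Proof.
rewrite ge0_integral_normal_prob; first last.
- by move=> x; rewrite lee_fin expR_ge0.
- by apply/measurable_EFinP; apply: measurableT_comp => //; exact: measurable_funM.
transitivity (\int[lebesgue_measure]_x
    ((expR (b ^+ 2 / 2))%:E * (normal_pdf b 1 x)%:E))%E.
  apply: eq_integral => x _; rewrite -!EFinM !normal_pdfE ?oner_neq0//; congr EFin.
  rewrite /normal_fun mulrCA [RHS]mulrCA; congr *%R.
  rewrite -!expRD; congr expR; by field.
rewrite ge0_integralZl//; first last.
- by move=> x _; rewrite lee_fin normal_pdf_ge0.
- by apply/measurable_EFinP; exact: measurable_normal_pdf.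
by rewrite integral_normal_pdf mule1.
Qed.

Lemma mgf_standard_normal (R : realType) d (T : measurableType d)
    (P : probability T R) (X : {RV P >-> R}) (b : R) :
  (forall A, measurable A -> distribution P X A = normal_prob 0 1 A) ->
  ('E_P[(fun t => expR (b * X t))%R] = (expR (b ^+ 2 / 2))%:E)%E.
Proof.
move=> XN.
(* [normal_prob] is a measure on [measurableTypeR R], whose display differs from
   that of the codomain of X. *)
have mX : measurable_fun setT (X : T -> measurableTypeR R) := measurable_funPT X.
pose Y : {RV P >-> measurableTypeR R} :=
  HB.pack (X : T -> measurableTypeR R) (isMeasurableFun.Build _ _ _ _ _ mX).
rewrite unlock -mgf_normal_prob.
rewrite -(@eq_measure_integral _ _ _ setT _ (distribution P Y)); last first.
  by move=> A mA _; exact: XN.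
rewrite ge0_integral_distribution//.
by apply/measurable_EFinP; apply: measurableT_comp => //; exact: measurable_funM.
Qed.

Lemma standard_normal_integrable_expR (R : realType) d (T : measurableType d)
    (P : probability T R) (X : {RV P >-> R}) (b : R) :
  (forall A, measurable A -> distribution P X A = normal_prob 0 1 A) ->
  P.-integrable setT (fun t => (expR (b * X t))%:E).
Proof.
move=> XN; apply/integrableP; split.
  by apply/measurable_EFinP; apply: measurableT_comp => //; exact: measurable_funM.
under eq_integral do rewrite gee0_abs ?lee_fin ?expR_ge0//.
by have := mgf_standard_normal b XN; rewrite unlock => ->; rewrite ltry.
Qed.

(** From 1 + y <= e^y at y = X and y = -X, |X| <= e^X + e^(-X), which is integrable. *)
Lemma standard_normal_Lfun1 (R : realType) d (T : measurableType d)
    (P : probability T R) (X : {RV P >-> R}) :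
  (forall A, measurable A -> distribution P X A = normal_prob 0 1 A) ->
  (X : T -> R) \in Lfun P 1.
Proof.
move=> XN; apply/Lfun1_integrable.
have intexp b := standard_normal_integrable_expR b XN.
apply: (le_integrable measurableT _ _
  (integrableD measurableT (intexp 1) (intexp (-1)))).
  exact/measurable_EFinP.
move=> t _ /=; rewrite lee_fin mul1r mulN1r.
rewrite [leRHS]ger0_norm ?addr_ge0 ?expR_ge0//.
have e1 := expR_ge1Dx (X t); have e2 := expR_ge1Dx (- X t).
have p1 := expR_ge0 (X t); have p2 := expR_ge0 (- X t).
by rewrite ler_norml; apply/andP; split; lra.
Qed.

(* Jensen: 1 + t E[X] <= E[e^(tX)] = e^(t^2/2) = 1 + O(t^2) forces E[X] = 0. *)
Lemma standard_normal_expectation (R : realType) d (T : measurableType d)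
    (P : probability T R) (X : {RV P >-> R}) :
  (forall A, measurable A -> distribution P X A = normal_prob 0 1 A) ->
  ('E_P[X] = 0)%E.
Proof.
move=> XN.
have X1 := standard_normal_Lfun1 XN.
have mE : ('E_P[X] = (fine 'E_P[X])%:E)%E by rewrite fineK// expectation_fin_num.
move: (fine _) mE => m mE.
have jensen t : 1 + t * m <= expR (t ^+ 2 / 2).
  have tX1 : (t \o* X : T -> R) \in Lfun P 1 by exact: Lfun_scale.
  rewrite -lee_fin -(mgf_standard_normal t XN) EFinD EFinM -mE -expectationZl//.
  rewrite -(expectation_cst P 1) -expectationD ?Lfun_cst// unlock.
  apply: le_integral => //.
  - by apply/Lfun1_integrable; rewrite rpredD ?Lfun_cst.
  - exact: standard_normal_integrable_expR.
  - by move=> s _; rewrite lee_fin/= mulrC expR_ge1Dx.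
rewrite {}mE; congr EFin; apply/eqP/negPn/negP => m0.
(* This [t] has the sign of [m] and is small enough that t^2 < t m < 1. *)
pose t := m / (m ^+ 2 + 1).
have m2 : 0 < m ^+ 2 by rewrite exprn_even_gt0.
have tm : t * m = m ^+ 2 / (m ^+ 2 + 1) by rewrite /t mulrAC -expr2.
have tt : t ^+ 2 = t * m / (m ^+ 2 + 1) by rewrite /t; field; lra.
have tm0 : 0 < t * m by rewrite tm divr_gt0//; lra.
have tm1 : t * m < 1 by rewrite tm ltr_pdivrMr; lra.
have ttm : t ^+ 2 < t * m by rewrite tt ltr_pdivrMr; nra.
(* Multiply [jensen] by 1 - t^2/2 <= e^(-t^2/2). As t m < 1, the left side exceeds 1 + t m - t^2 >
   1, a contradiction. *)
have : (1 + t * m) * (1 - t ^+ 2 / 2) <= 1.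
  by rewrite -[leRHS](expRxMexpNx_1 (t ^+ 2 / 2)) ler_pM ?expR_ge1Dx//; lra.
clearbody t; nra.
Qed.

(** * Closed form of [Phi] in the Gaussian linear case *)

Definition Phi_closed (R : realType) (a x q : R) : R :=
  a * x + a * (1 - x ^+ 2) * (1 - q) / 2
  + 2^-1 * (q / (1 - q)) + 2^-1 * ln ((1 - x ^+ 2) * (1 - q)).

(** The logarithm of the inner moment generating function is affine in [S] and [Z], so the outer
    expectation follows from the zero means of [G] and [Z]. *)
Lemma Phi_gaussian (R : realType) d (T : measurableType d) (P : probability T R)
    (Z W G S : {RV P >-> R}) (lambda alpha x q : R) :
  0 < lambda ->
  (forall A, measurable A -> distribution P Z A = normal_prob 0 1 A) ->
  (forall A, measurable A -> distribution P W A = normal_prob 0 1 A) ->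
  (forall A, measurable A -> distribution P G A = normal_prob 0 1 A) ->
  (forall t, S t = Num.sqrt lambda + G t) ->
  -1 < x < 1 -> 0 <= q < 1 ->
  Phi (fun y => Num.sqrt lambda * y) alpha S Z W x q =
  (Phi_closed (alpha * lambda) x q)%:E.
Proof.
move=> l0 ZN WN GN SG x1 /andP[q0 q1].
have x2 : 0 <= 1 - x ^+ 2 by case/andP: x1 => ? ?; nra.
have r0 : 0 <= 1 - q by lra.
pose c := lambda * x + lambda * (1 - x ^+ 2) * (1 - q) / 2.
(* The square root is exposed so that [ring] can match the product of the slope
   [Num.sqrt lambda * x] with the mean [Num.sqrt lambda] of [S]. *)
have cE : c = Num.sqrt lambda ^+ 2 * x + lambda * (1 - x ^+ 2) * (1 - q) / 2.
  by rewrite sqr_sqrtr ?ltW.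
pose e := Num.sqrt lambda * Num.sqrt ((1 - x ^+ 2) * q).
have inner s z : lne 'E_P[(fun w => expR (Num.sqrt lambda * (x * s +
    Num.sqrt ((1 - x ^+ 2) * q) * z +
    Num.sqrt ((1 - x ^+ 2) * (1 - q)) * W w)))%R] =
  (Num.sqrt lambda * x * s + e * z + lambda * (1 - x ^+ 2) * (1 - q) / 2)%:E.
  pose k := expR (Num.sqrt lambda * x * s + e * z).
  pose b := Num.sqrt lambda * Num.sqrt ((1 - x ^+ 2) * (1 - q)).
  rewrite (_ : (fun w => _) = k \o* (fun w => expR (b * W w))); last first.
    by apply/funext => w /=; rewrite /k /e /b -expRD; congr expR; ring.
  rewrite expectationZl; last first.
    by apply/Lfun1_integrable; exact: standard_normal_integrable_expR.
  rewrite (mgf_standard_normal b WN) -EFinM -expRD lne_EFin ?expR_gt0// expRK.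
  congr EFin; congr (_ + _ / 2).
  by rewrite /b exprMn !sqr_sqrtr ?mulr_ge0// ?ltW// mulrA.
rewrite /Phi; under eq_integral do rewrite inner.
have -> : (\int[P]_t (Num.sqrt lambda * x * S t + e * Z t +
    lambda * (1 - x ^+ 2) * (1 - q) / 2)%:E = c%:E)%E.
  transitivity ('E_P[(cst c \+ ((Num.sqrt lambda * x) \o* G \+ e \o* Z))%R])%E.
    rewrite unlock; apply: eq_integral => t _; congr EFin => /=.
    rewrite SG cE; ring.
  clearbody c; have G1 := standard_normal_Lfun1 GN.
  have Z1 := standard_normal_Lfun1 ZN.
  rewrite expectationD ?Lfun_cst//; last by rewrite rpredD ?Lfun_scale.
  rewrite expectationD ?Lfun_scale// !expectationZl// expectation_cst.
  by rewrite !standard_normal_expectation// !mule0 !adde0.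
rewrite -EFinM -EFinD; congr EFin; rewrite /Phi_closed /c; ring.
Qed.

(** * Strict saddle inequalities for the closed form *)

Lemma ln_le_subr1 (R : realType) (y : R) : 0 < y -> ln y <= y - 1.
Proof.
by move=> y0; have := @le_ln1Dx R (y - 1); rewrite [1 + _]addrC subrK; apply; lra.
Qed.

(* x |-> Phi_closed a x q* is strictly concave with critical point x*; bounding
   its logarithm by ln y <= y - 1 leaves exactly -c (x - x* )^2. *)
Lemma Phi_closed_lt_saddle (R : realType) (a x : R) :
  0 < a -> -1 < x < 1 -> x != a / (1 + a) ->
  Phi_closed a x (a / (1 + 2 * a)) <
  Phi_closed a (a / (1 + a)) (a / (1 + 2 * a)).
Proof.
move=> a0 /andP[x1 x2] xn.
have s0 : 0 < 1 - x ^+ 2 by nra.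
have rE : 1 - a / (1 + 2 * a) = (1 + a) / (1 + 2 * a) by field; lra.
have sE : 1 - (a / (1 + a)) ^+ 2 = (1 + 2 * a) / (1 + a) ^+ 2 by field; lra.
have r0 : 0 < 1 - a / (1 + 2 * a) by rewrite rE divr_gt0//; lra.
have ss0 : 0 < 1 - (a / (1 + a)) ^+ 2 by rewrite sE divr_gt0 ?exprn_gt0//; lra.
have := ln_le_subr1 (divr_gt0 s0 ss0).
rewrite ln_div ?posrE// => lnle.
rewrite /Phi_closed !lnM ?posrE//.
have d0 : 0 < (x - a / (1 + a)) ^+ 2 by rewrite exprn_even_gt0//= subr_eq0.
(* The two terms are a r* / 2, from the quadratic part of the closed form, and 1 / (2 s* ), from the
   bound on the logarithm. *)
pose c := a * ((1 + a) / (1 + 2 * a)) / 2 + (1 + a) ^+ 2 / (2 * (1 + 2 * a)).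
have c0 : 0 < c by rewrite addr_gt0// !(divr_gt0, mulr_gt0, exprn_gt0)//; lra.
have : 0 < c * (x - a / (1 + a)) ^+ 2 by exact: mulr_gt0.
have -> : c * (x - a / (1 + a)) ^+ 2 =
  a * (a / (1 + a)) + a * (1 - (a / (1 + a)) ^+ 2) * (1 - a / (1 + 2 * a)) / 2
  - (a * x + a * (1 - x ^+ 2) * (1 - a / (1 + 2 * a)) / 2)
  - 2^-1 * ((1 - x ^+ 2) / (1 - (a / (1 + a)) ^+ 2) - 1).
  rewrite rE sE /c; field; lra.
lra.
Qed.

(** Here ln r needs a lower bound, hence the ratio r* / r. What remains is A r + B / r up to a
    constant, with A, B > 0 and its minimum at r = r*. *)
Lemma Phi_closed_saddle_lt (R : realType) (a q : R) :
  0 < a -> 0 <= q < 1 -> q != a / (1 + 2 * a) ->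
  Phi_closed a (a / (1 + a)) (a / (1 + 2 * a)) < Phi_closed a (a / (1 + a)) q.
Proof.
move=> a0 /andP[q0 q1] qn.
have rq0 : 0 < 1 - q by lra.
have rE : 1 - a / (1 + 2 * a) = (1 + a) / (1 + 2 * a) by field; lra.
have sE : 1 - (a / (1 + a)) ^+ 2 = (1 + 2 * a) / (1 + a) ^+ 2 by field; lra.
have r0 : 0 < 1 - a / (1 + 2 * a) by rewrite rE divr_gt0//; lra.
have ss0 : 0 < 1 - (a / (1 + a)) ^+ 2 by rewrite sE divr_gt0 ?exprn_gt0//; lra.
have := ln_le_subr1 (divr_gt0 r0 rq0).
rewrite ln_div ?posrE// => lnle.
rewrite /Phi_closed !lnM ?posrE//.
have d0 : 0 < (q - a / (1 + 2 * a)) ^+ 2 by rewrite exprn_even_gt0//= subr_eq0.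
(* This is a s* / (2 r), obtained from the stationarity equation a s* = q* / r*^2. *)
pose c := a * (1 + 2 * a) / (2 * (1 + a) ^+ 2 * (1 - q)).
have c0 : 0 < c by rewrite !(divr_gt0, mulr_gt0, exprn_gt0)//; lra.
have : 0 < c * (q - a / (1 + 2 * a)) ^+ 2 by exact: mulr_gt0.
have -> : c * (q - a / (1 + 2 * a)) ^+ 2 =
  a * (1 - (a / (1 + a)) ^+ 2) * (1 - q) / 2 + 2^-1 * (q / (1 - q))
  - (a * (1 - (a / (1 + a)) ^+ 2) * (1 - a / (1 + 2 * a)) / 2
     + 2^-1 * (a / (1 + 2 * a) / (1 - a / (1 + 2 * a))))
  - 2^-1 * ((1 - a / (1 + 2 * a)) / (1 - q) - 1).
  rewrite rE sE /c; field; lra.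
lra.
Qed.

(** * From a strict saddle point to the sup-inf problem *)

(** The infimum at [xs] is [F xs qs]; at any other x it is at most [F x qs], which is strictly
    smaller. *)
Lemma strict_saddle_achieved (R : realType) (F : R -> R -> \bar R) (xs qs : R) :
  0 <= xs < 1 -> 0 <= qs < 1 ->
  (forall x, -1 < x < 1 -> x != xs -> (F x qs < F xs qs)%E) ->
  (forall q, 0 <= q < 1 -> q != qs -> (F xs qs < F xs q)%E) ->
  achieved_at_unique_pair F xs qs.
Proof.
move=> xs01 qs01 Fx Fq.
have infE : inf_q F xs = F xs qs.
  apply/eqP; rewrite eq_le; apply/andP; split.
    by apply: ereal_inf_lbound; exists qs => //=; rewrite in_itv/=.
  apply: le_ereal_inf_tmp => y [q] /=; rewrite in_itv/= => q01 <-.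
  by have [->//|qn] := eqVneq q qs; rewrite ltW// Fq.
have inf_lt x : -1 < x < 1 -> x != xs -> (inf_q F x < F xs qs)%E.
  move=> x01 xn; apply: le_lt_trans (Fx _ x01 xn).
  by apply: ereal_inf_lbound; exists qs => //=; rewrite in_itv/=.
have supE : sup_inf F = F xs qs.
  apply/eqP; rewrite eq_le; apply/andP; split.
    apply: ge_ereal_sup => y [x] /=; rewrite in_itv/= => x01 <-.
    by have [->|xn] := eqVneq x xs; rewrite ?infE// ltW// inf_lt.
  rewrite -infE; apply: ereal_sup_ubound; exists xs => //=.
  by rewrite in_itv/=; lra.
split; split.
- by rewrite infE supE.
- move=> x [x01 xE]; apply/eqP/negPn/negP; rewrite eq_sym => xn.
  have x11 : -1 < x < 1 by lra.
  by have := inf_lt x x11 xn; rewrite xE supE ltxx.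
- by rewrite infE.
- move=> q [q01 qE]; apply/eqP/negPn/negP; rewrite eq_sym => qn.
  by have := Fq q q01 qn; rewrite qE infE ltxx.
Qed.

Unset Implicit Arguments.

Theorem proposition3p6 (R : realType) (lambda : R) (lambda_gt0 : 0 < lambda) :
  exists alpha0 : R, 0 < alpha0 /\
  forall alpha : R, 0 < alpha -> alpha < alpha0 ->
  forall (d : measure_display) (T : measurableType d) (P : probability T R)
    (Z W G S : {RV P >-> R}),
  (forall A : set R, measurable A -> distribution P Z A = normal_prob 0 1 A) ->
  (forall A : set R, measurable A -> distribution P W A = normal_prob 0 1 A) ->
  (forall A : set R, measurable A -> distribution P G A = normal_prob 0 1 A) ->
  (forall t : T, S t = Num.sqrt lambda + G t) ->
  mutually_independent3 Z W S ->
  exists xBayes qBayes : R,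
    [/\ achieved_at_unique_pair
          (Phi (fun y : R => Num.sqrt lambda * y) alpha S Z W) xBayes qBayes,
        xBayes = qBayes / (1 - qBayes),
        alpha * lambda * (1 - xBayes ^+ 2) = qBayes / (1 - qBayes) ^+ 2,
        xBayes = alpha * lambda / (1 + alpha * lambda)
      & qBayes = alpha * lambda / (1 + 2 * (alpha * lambda))].
Proof.
exists 1; split=> // alpha alpha0 _ d T P Z W G S ZN WN GN SG _.
pose a := alpha * lambda.
have a0 : 0 < a by exact: mulr_gt0.
have x01 : 0 <= a / (1 + a) < 1.
  by rewrite divr_ge0 ?ltr_pdivrMr; lra.
have q01 : 0 <= a / (1 + 2 * a) < 1.
  by rewrite divr_ge0 ?ltr_pdivrMr; lra.
exists (a / (1 + a)), (a / (1 + 2 * a)); rewrite -/a; split=> //.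
- have PhiE := Phi_gaussian alpha lambda_gt0 ZN WN GN SG.
  apply: strict_saddle_achieved => // [x x1 xn|q q1 qn].
    by rewrite !PhiE ?lte_fin ?Phi_closed_lt_saddle//; lra.
  by rewrite !PhiE ?lte_fin ?Phi_closed_saddle_lt//; lra.
- by field; lra.
- by field; lra.
Qed.
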